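(* Let $s>1/3$ and $0<\gamma<1/3$. Then there exists a value $\beta_{s,\gamma}>0$ such that for every $\beta\in[0,\beta_{s,\gamma})$ there exists a nonempty class of real initial data $(a_j(0))_{j\ge 0}$ with $\sum_{j\ge 0}2^{2sj}a_j(0)^2<\infty$ for which the corresponding solutions of the system $$\frac{da_j}{dt}=\big(2^{j}a_{j-1}^2-2^{j+1}a_ja_{j+1}\big)+\beta\big(2^{j}a_{j-1}a_j-2^{j+1}a_{j+1}^2\big)-2^{2\gamma j}a_j,\qquad j\ge 0,\quad a_{-1}\equiv 0,$$ blow up in finite time in $H^s$-norm; more precisely, for each solution $a(t)=(a_j(t))_{j\ge0}$ on $[0,\infty)$ with initial data in this class, the function $t\mapsto \|a(t)\|_s^2$ is not locally integrable on $[0,\infty)$.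
   Context: The $H^s$-norm of a real sequence $a=(a_0,a_1,\dots)$ is given by $\|a\|_s^2:=\sum_{j=0}^\infty 2^{2sj}a_j^2\in[0,\infty]$. A solution on $[0,\infty)$ is a sequence of real-valued functions $a(t)=(a_j(t))_{j\ge 0}$, each continuously differentiable on $[0,\infty)$ (one-sided derivative at $0$), satisfying the infinite system of ODEs for all $t\ge 0$ and $j\ge 0$, with the boundary convention $a_{-1}(t)\equiv 0$, and taking the given initial values at $t=0$. ''Not locally integrable on $[0,\infty)$'' means that $\int_0^T\|a(t)\|_s^2\,dt=\infty$ for some finite $T>0$. The class of initial data may depend on $s,\gamma,\beta$. *)

(* Defs.v *)
From HB Require Import structures.
From mathcomp Require Import all_boot all_order all_algebra.
From mathcomp Require Import all_classical all_reals all_analysis.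
Set Implicit Arguments.
Unset Strict Implicit.
Unset Printing Implicit Defensive.
Import Order.TTheory GRing.Theory Num.Theory.
Import numFieldNormedType.Exports.
Local Open Scope classical_set_scope.
Local Open Scope ring_scope.

Definition Hs_norm2 (R : realType) (s : R) (a : nat -> R) : \bar R :=
  (\sum_(0 <= j <oo) (2 `^ (2 * s * j%:R) * a j ^+ 2)%:E)%E.

(* [a_(j - 1)], with the convention [a_(-1) = 0]. *)
Definition prev (R : realType) (a : nat -> R) (j : nat) : R :=
  if j is k.+1 then a k else 0.

Definition dyadic_rhs (R : realType) (gamma beta : R) (a : nat -> R) (j : nat)
    : R :=
  (2 ^+ j * prev a j ^+ 2 - 2 ^+ j.+1 * a j * a j.+1)
  + beta * (2 ^+ j * prev a j * a j - 2 ^+ j.+1 * a j.+1 ^+ 2)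
  - 2 `^ (2 * gamma * j%:R) * a j.

(* Derivative of [f] at [t] as a function on [0, +oo[: one-sided at [0]. The
   values of [f] at negative arguments are irrelevant. *)
Definition is_derive0y (R : realType) (f : R -> R) (t l : R) : Prop :=
  (0 < t -> is_derive t 1 f l) /\
  (t = 0 -> (f h - f 0) / h @[h --> 0^'+] --> l).

Definition C1_0y (R : realType) (f : R -> R) : Prop :=
  exists df : R -> R,
    {within [set t | 0 <= t], continuous df} /\
    (forall t, 0 <= t -> is_derive0y f t (df t)).

(* [a t j] is the [j]-th component at time [t]. *)
Definition is_solution (R : realType) (gamma beta : R) (a0 : nat -> R)
    (a : R -> nat -> R) : Prop :=
  [/\ forall j, C1_0y (fun t => a t j),
      forall t j, 0 <= t ->
        is_derive0y (fun u => a u j) t (dyadic_rhs gamma beta (a t) j)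
    & forall j, a 0 j = a0 j].

(* Main.v *)
(** Put x = 2^sigma with 1/3 < sigma <= s and sigma < 1 - 2 gamma, and let
    b_j = 2^(sigma j) a_j.  The linear functional S = sum_j 2^((2 sigma - 1) j) a_j
    has as derivative a quadratic form in b minus a dissipative term.  At beta = 0
    the form is sum_j (x^2 b_j^2 - (2/x) b_j b_(j+1)), which is positive definite
    because x^3 > 2; it stays so for small beta, whatever the signs of the a_j.
    Since sigma < 1 and sigma < 1 - 2 gamma, both S and the dissipation are
    controlled by the l2 norm of b, so S' >= c S^2 - C and S blows up when S(0) is
    large.  Truncating the sum at N costs only x^2 (b_N^2 + b_(N+1)^2), whose time
    integral becomes small along a sequence of N as soon as the H^s norm is square
    integrable in time; hence a single finite truncation gives the contradiction. *)

Require Import Defs.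
From HB Require Import structures.
From mathcomp Require Import all_boot all_order all_algebra.
From mathcomp Require Import all_classical all_reals all_analysis.
From mathcomp Require Import ring lra.
Set Implicit Arguments.
Unset Strict Implicit.
Unset Printing Implicit Defensive.
Import Order.TTheory GRing.Theory Num.Theory.
Import numFieldNormedType.Exports.
Local Open Scope classical_set_scope.
Local Open Scope ring_scope.

(** * Coercivity of the truncated quadratic form *)

(* The last term of the sum does not telescope; the coefficient of the resulting
   [b_N ^ 2] is the one for which the induction step is a sum of squares. *)
Lemma flux_sum_ge (R : realType) (x beta : R) (a : nat -> R) (N : nat) :
  0 < x -> 0 <= beta ->
  2 * beta * (x + 2 / x ^+ 2) <= x ^+ 2 - 2 / x ->
  (x ^+ 2 - 2 / x) / 2 * (\sum_(j < N.+1) (x ^+ j * a j) ^+ 2)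
    - (x ^+ 2 - x^-1 - beta * x / 2) * (x ^+ N * a N) ^+ 2
    - 2 / x * (x ^+ N * a N) * (x ^+ N.+1 * a N.+1)
    - beta * (2 / x ^+ 2) * (x ^+ N.+1 * a N.+1) ^+ 2 <=
  \sum_(j < N.+1) (x ^+ 2 / 2) ^+ j *
    ((2 ^+ j * Defs.prev a j ^+ 2 - 2 ^+ j.+1 * a j * a j.+1)
     + beta * (2 ^+ j * Defs.prev a j * a j - 2 ^+ j.+1 * a j.+1 ^+ 2)).
Proof.
move=> x0 beta0 hb.
have x1 : x != 0 by rewrite gt_eqF.
have y0 : 0 < x^-1 by rewrite invr_gt0.
elim: N => [|N IH].
  rewrite !big_ord_recl !big_ord0 /= !expr0 !mul1r !expr1.
  rewrite -subr_ge0 [X in 0 <= X](_ : _ =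
    (x ^+ 2 / 2 - beta * x / 2) * a 0 ^+ 2); last by field.
  apply: mulr_ge0 (sqr_ge0 _).
  have : 0 <= beta * (2 / x ^+ 2) by rewrite mulr_ge0 ?divr_ge0 ?sqr_ge0.
  by nra.
rewrite [X in _ <= X]big_ord_recr [X in _ * X - _ - _ - _]big_ord_recr /=.
set S := \sum_(j < N.+1) (x ^+ j * a j) ^+ 2 in IH *.
set L := \sum_(j < N.+1) _ in IH *.
set u := a N in IH *; set v := a N.+1 in IH *; set w := a N.+2.
have hc : 2 ^+ N != 0 :> R by rewrite expf_neq0// pnatr_eq0.
apply: le_trans (lerD IH (lexx _)).
(* The indefinite products of neighbouring modes are completed to squares: the flux term gives the
   square of the difference, the [beta] term that of the sum. The remaining diagonal coefficient is
   nonnegative exactly by [hb]. *)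
rewrite -subr_ge0 [X in 0 <= X](_ : _ =
  x^-1 * (x ^+ N * u - x ^+ N.+1 * v) ^+ 2 +
  (beta * x / 2) * (x ^+ N * u + x ^+ N.+1 * v) ^+ 2 +
  ((x ^+ 2 - 2 / x) / 2 - beta * (x + 2 / x ^+ 2)) * (x ^+ N.+1 * v) ^+ 2).
  by rewrite !addr_ge0// mulr_ge0 ?sqr_ge0// ?divr_ge0 ?mulr_ge0 ?(ltW x0) ?(ltW y0)//; lra.
rewrite expr_div_n (exprAC _ 2) 2!(exprS _ N.+1) !(exprS _ N).
set p := x ^+ N; set t := 2 ^+ N in hc *.
by field; rewrite x1 hc.
Qed.

(** Completing the square in each [b j] leaves [c ^+ 2 / (4 * e) * q ^+ (2 * j)]; the geometric
    series then bounds the total independently of [N]. *)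
Lemma geom_weighted_AMGM (R : realFieldType) (q e c : R) (b : nat -> R) N :
  0 <= q < 1 -> 0 < e ->
  c * \sum_(j < N) q ^+ j * b j <=
  e * (\sum_(j < N) b j ^+ 2) + c ^+ 2 / (4 * e * (1 - q ^+ 2)).
Proof.
move=> /andP[q0 q1] e0.
have q21 : 0 < 1 - q ^+ 2 by rewrite subr_gt0 expr_lt1.
apply: (@le_trans _ _ (\sum_(j < N) (e * b j ^+ 2 +
    c ^+ 2 / (4 * e) * (q ^+ 2) ^+ j))).
  rewrite mulr_sumr ler_sum// => j _.
  rewrite -subr_ge0 [X in 0 <= X](_ : _ =
     e * (b j - c * q ^+ j / (2 * e)) ^+ 2); first by rewrite mulr_ge0 ?sqr_ge0 ?(ltW e0).
  by rewrite exprAC; field; rewrite gt_eqF.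
rewrite big_split /= -!mulr_sumr lerD2l.
have -> : c ^+ 2 / (4 * e * (1 - q ^+ 2)) =
          c ^+ 2 / (4 * e) * (1 - q ^+ 2)^-1 by field; rewrite !gt_eqF.
rewrite ler_wpM2l ?divr_ge0 ?sqr_ge0 ?mulr_ge0 ?(ltW e0)//.
rewrite -[leRHS]mul1r ler_pdivlMr//.
by have := subrX1 (q ^+ 2) N; have := exprn_ge0 N (sqr_ge0 q); nra.
Qed.

Lemma weighted_rhs_ge (R : realType) (gamma beta x : R) (a : nat -> R) N :
  0 < x -> 0 < x ^+ 2 - 2 / x -> 2 `^ (2 * gamma) * x / 2 < 1 ->
  0 <= beta -> 2 * beta * (x + 2 / x ^+ 2) <= x ^+ 2 - 2 / x ->
  (x ^+ 2 - 2 / x) / 4 * (\sum_(j < N.+1) (x ^+ j * a j) ^+ 2)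
    - ((x ^+ 2 - 2 / x) * (1 - (2 `^ (2 * gamma) * x / 2) ^+ 2))^-1
    - x ^+ 2 * ((x ^+ N * a N) ^+ 2 + (x ^+ N.+1 * a N.+1) ^+ 2) <=
  \sum_(j < N.+1) (x ^+ 2 / 2) ^+ j * dyadic_rhs gamma beta a j.
Proof.
move=> x0 eta0 r1 beta0 hb.
have y0 : 0 < x^-1 by rewrite invr_gt0.
set r := 2 `^ (2 * gamma) * x / 2 in r1 *.
have r0 : 0 <= r by rewrite divr_ge0// mulr_ge0 ?powR_ge0 ?ltW.
have r21 : 0 < 1 - r ^+ 2 by rewrite subr_gt0 expr_lt1.
have flux := flux_sum_ge a N x0 beta0 hb.
have e0 : 0 < (x ^+ 2 - 2 / x) / 4 by lra.
have r01 : 0 <= r < 1 by rewrite r0 r1.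
have := geom_weighted_AMGM 1 (fun j => x ^+ j * a j) N.+1 r01 e0.
rewrite expr1n mul1r.
have -> : 1 / (4 * ((x ^+ 2 - 2 / x) / 4) * (1 - r ^+ 2)) =
    ((x ^+ 2 - 2 / x) * (1 - r ^+ 2))^-1.
  by rewrite mul1r; congr (_^-1); field; rewrite gt_eqF.
have -> : \sum_(j < N.+1) (x ^+ 2 / 2) ^+ j * dyadic_rhs gamma beta a j =
  \sum_(j < N.+1) (x ^+ 2 / 2) ^+ j *
    ((2 ^+ j * Defs.prev a j ^+ 2 - 2 ^+ j.+1 * a j * a j.+1)
     + beta * (2 ^+ j * Defs.prev a j * a j - 2 ^+ j.+1 * a j.+1 ^+ 2)) -
  \sum_(j < N.+1) r ^+ j * (x ^+ j * a j).
  rewrite -sumrB; apply: eq_bigr => j _; rewrite /dyadic_rhs mulrBr; congr (_ - _).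
  by rewrite powRrM powR_mulrn ?powR_ge0// !mulrA -!exprMn; congr (_ ^+ _ * _);
     rewrite /r; field.
set Q := \sum_(j < N.+1) (x ^+ j * a j) ^+ 2 in flux *.
set D := \sum_(j < N.+1) r ^+ j * _.
set L := \sum_(j < N.+1) _ in flux *.
set u := x ^+ N * a N in flux *; set v := x ^+ N.+1 * a N.+1 in flux *.
set Z := (_ * (1 - r ^+ 2))^-1 => damp.
suff : (x ^+ 2 - x^-1 - beta * x / 2) * u ^+ 2 + 2 / x * u * v +
    beta * (2 / x ^+ 2) * v ^+ 2 <= x ^+ 2 * (u ^+ 2 + v ^+ 2) by lra.
have bx0 : 0 <= beta * x by rewrite mulr_ge0// ltW.
rewrite -subr_ge0 [X in 0 <= X](_ : _ = x^-1 * (u - v) ^+ 2 +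
   beta * x / 2 * u ^+ 2 + (x ^+ 2 - x^-1 - beta * (2 / x ^+ 2)) * v ^+ 2);
  last by field; rewrite gt_eqF.
have : 0 <= beta * (2 / x ^+ 2) by rewrite mulr_ge0 ?divr_ge0 ?sqr_ge0.
by move=> ?; rewrite !addr_ge0 // mulr_ge0 ?sqr_ge0 ?(ltW y0)//; lra.
Qed.

(** * Riccati inequality with an integrating factor *)

(* The right-hand side is the derivative of [S * p ^ 4 - m * p ^ 3] when
   [p' = - (c / 2) * m], with [S = \sum_j q ^ j * b_j] and
   [c = eta * (1 - q ^ 2) / 4]. *)
Lemma riccati_step_ge (R : realFieldType) (q eta C D m p S' : R) (b : nat -> R) N :
  0 <= q < 1 -> 0 < eta -> 0 <= D -> 0 <= p <= 1 ->
  2 * C <= eta * (1 - q ^+ 2) / 4 * m ^+ 2 ->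
  eta / 4 * (\sum_(j < N) b j ^+ 2) - C - D <= S' ->
  - D <= S' * p ^+ 4
    - 2 * (eta * (1 - q ^+ 2) / 4) * m * (\sum_(j < N) q ^+ j * b j) * p ^+ 3
    + 3 / 2 * (eta * (1 - q ^+ 2) / 4) * m ^+ 2 * p ^+ 2.
Proof.
move=> q01 eta0 D0 /andP[p0 p1] hm hS.
set c := eta * (1 - q ^+ 2) / 4 in hm *.
have q21 : 0 < 1 - q ^+ 2.
  by case/andP: q01 => q0 q1; rewrite subr_gt0 expr_lt1.
have e0 : 0 < eta / 4 by lra.
(* Applied to [p * b j], the inequality leaves the constant [c * m ^+ 2]. After multiplication by
   [p ^+ 2] it takes 1 of the coefficient 3/2; the constant [C] takes the remaining 1/2. *)
have := geom_weighted_AMGM (2 * c * m) (fun j => p * b j) N q01 e0.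
have -> : (2 * c * m) ^+ 2 / (4 * (eta / 4) * (1 - q ^+ 2)) = c * m ^+ 2.
  by rewrite /c; field; rewrite !gt_eqF.
under eq_bigr do rewrite mulrCA.
under [in X in _ <= _ * X + _ -> _]eq_bigr do rewrite exprMn.
rewrite -!mulr_sumr.
set S := \sum_(j < N) q ^+ j * b j; set Q := \sum_(j < N) b j ^+ 2 in hS * => hA.
have p20 : 0 <= p ^+ 2 by rewrite sqr_ge0.
have p21 : p ^+ 2 <= 1 by rewrite expr_le1.
have p40 : 0 <= p ^+ 4 by rewrite exprn_ge0.
have p41 : p ^+ 4 <= 1 by rewrite expr_le1.
have h1 := ler_wpM2r p40 hS.
have h2 := ler_wpM2r p20 hA.
have h3 : D * p ^+ 4 <= D by rewrite ler_piMr.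
have h4 : 2 * C * p ^+ 4 <= c * m ^+ 2 * p ^+ 2.
  apply: (@le_trans _ _ (c * m ^+ 2 * p ^+ 4)); first exact: ler_wpM2r.
  apply: ler_wpM2l; last by rewrite (exprD p 2 2) ler_piMr.
  by rewrite mulr_ge0 ?sqr_ge0// /c divr_ge0// mulr_ge0 ?ltW.
move: h1 h2 h3 h4.
have -> : p ^+ 4 = p ^+ 2 * p ^+ 2 by ring.
have -> : p ^+ 3 = p * p ^+ 2 by ring.
set P := p ^+ 2; lra.
Qed.

(** * Calculus and integration in time *)

(** Adding to [F] the primitive of [g] gives a nondecreasing function. Derivatives are asked only in
    the open interval, so that the one-sided derivative at time 0 enters through continuity
    alone. *)
Lemma increment_ge_integral (R : realType) (F F' g : R -> R) (a b : R) :
  a < b -> {within `[a, b], continuous F} -> {within `[a, b], continuous g} ->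
  (forall t, t \in `]a, b[ -> is_derive t 1 F (F' t)) ->
  (forall t, t \in `]a, b[ -> - g t <= F' t) ->
  F a - (\int[lebesgue_measure]_(t in `[a, b]) g t)%R <= F b.
Proof.
move=> ab cF cg dF hF.
have ig : lebesgue_measure.-integrable `[a, b] (EFin \o g).
  by apply: continuous_compact_integrable => //; exact: segment_compact.
pose E x := (\int[lebesgue_measure]_(t in `[a, x]) g t)%R.
have dE t : t \in `]a, b[ -> is_derive t 1 E (g t).
  move=> tab; have := tab; rewrite in_itv/= => /andP[at_ tb].
  have gt : {for t, continuous g}.
    have : {in `]a, b[, continuous g}.
      by have [] := (continuous_within_itvP g ab).1 cg.
    by apply.
  have [dE eE] := continuous_FTC1_closed tb ig at_ gt.
  by apply: DeriveDef => //; rewrite -derive1E.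
have cE : {within `[a, b], continuous E}.
  by apply: parameterized_integral_continuous => //; exact: ltW.
have dG t : t \in `]a, b[ -> is_derive t 1 (F + E) (F' t + g t).
  by move=> tab; apply: is_deriveD; [exact: dF|exact: dE].
have /(_ a b (lexx _) (ltW ab) (lexx _)) : forall x y, a <= x -> x <= y ->
    y <= b -> (F + E) x <= (F + E) y.
  apply: ger0_derive1_ndecr.
  - by move=> t /dG [].
  - move=> t tab; have [_] := dG t tab; rewrite derive1E => ->.
    by have := hF t tab; lra.
  - by move=> t; apply: cvgD; [exact: cF|exact: cE].
rewrite /E !fctE set_itv1 Rintegral_set1 addr0 => ?; lra.
Qed.

(** Exchanging sum and integral makes the integrals of the [f j] a convergent series of nonnegative
    terms, whose tail dominates two consecutive terms. *)
Lemma consecutive_integrals_small (R : realType) (f : nat -> R -> R) (T e : R) :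
  (forall j t, 0 <= f j t) -> (forall j, {within `[0, T], continuous (f j)}) ->
  (\int[lebesgue_measure]_(t in `[0%R, T])
     (\sum_(0 <= j <oo) (f j t)%:E) < +oo)%E -> 0 < e ->
  exists N, (\int[lebesgue_measure]_(t in `[0%R, T]) (f N t + f N.+1 t))%R < e.
Proof.
move=> f0 cf + e0.
have ifn j : lebesgue_measure.-integrable `[0, T] (EFin \o f j).
  by apply: continuous_compact_integrable => //; exact: segment_compact.
have If0 j : (0 <= \int[lebesgue_measure]_(t in `[0%R, T]) (f j t)%:E)%E.
  by apply: integral_ge0 => t _; rewrite lee_fin.
rewrite integral_nneseries//; last 2 first.
- by move=> j; exact: measurable_int (ifn j).
- by move=> j t _; rewrite lee_fin.
move=> /nneseries_tail_cvg /(_ (fun j _ => If0 j)) tail.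
have e0' : (0 < e%:E)%E by rewrite lte_fin.
have [N _ /(_ N (leqnn N)) /= hN] := tail _ (open_ereal_lt' e0').
exists N; rewrite RintegralD//.
rewrite -lte_fin; apply: le_lt_trans hN.
rewrite EFinD !fineK; last 2 first.
- exact: integrable_fin_num (ifn N.+1).
- exact: integrable_fin_num (ifn N).
apply: le_trans (nneseries_lim_ge N.+2 _) => //.
by rewrite !big_nat_recr//= big_geq// add0e.
Qed.

Lemma is_derive0y_continuous (R : realType) (f l : R -> R) (T : R) :
  0 < T -> (forall t, 0 <= t -> is_derive0y f t (l t)) ->
  {within `[0, T], continuous f}.
Proof.
move=> T0 df; apply/continuous_within_itvP => //.
have fc t : 0 < t -> {for t, continuous f}.
  move=> t0; have [/(_ t0) [dft _] _] := df t (ltW t0).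
  exact/differentiable_continuous/derivable1_diffP.
split.
- by move=> t; rewrite in_itv/= => /andP[t0 _]; exact: fc.
- have [_ /(_ erefl) f'0] := df 0 (lexx _).
  have h0 : h @[h --> (0:R)^'+] --> (0:R) by exact: cvg_at_right_filter cvg_id.
  have : (f h - f 0) / h * h + f 0 @[h --> 0^'+] --> l 0 * 0 + f 0.
    exact: cvgD (cvgM f'0 h0) (cvg_cst (f 0)).
  rewrite mulr0 add0r; apply: cvg_trans; apply: near_eq_cvg.
  near=> h; have h1 : h != 0 by rewrite gt_eqF.
  by rewrite divfK// subrK.
- by apply: cvg_at_left_filter; exact: fc.
Unshelve. all: by end_near. Qed.

(** * Comparison with an exploding barrier *)

(** The functional [F] below starts at the excess of the initial weighted sum over [m] and vanishes
    at the explosion time of the barrier. The excess is therefore at most what leaves through the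
    truncation at [N] in that time. *)
Lemma initial_transfer_le (R : realType) (gamma beta x m : R) (a0 : nat -> R)
    (a : R -> nat -> R) N :
  0 < x < 2 -> 0 < x ^+ 2 - 2 / x -> 2 `^ (2 * gamma) * x / 2 < 1 ->
  0 <= beta -> 2 * beta * (x + 2 / x ^+ 2) <= x ^+ 2 - 2 / x ->
  0 < m ->
  2 / ((x ^+ 2 - 2 / x) * (1 - (2 `^ (2 * gamma) * x / 2) ^+ 2)) <=
    (x ^+ 2 - 2 / x) * (1 - (x / 2) ^+ 2) / 4 * m ^+ 2 ->
  is_solution gamma beta a0 a ->
  \sum_(j < N.+1) (x ^+ 2 / 2) ^+ j * a0 j - m <=
  (\int[lebesgue_measure]_(t in
      `[0%R, (2 / ((x ^+ 2 - 2 / x) * (1 - (x / 2) ^+ 2) / 4 * m))%R])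
    (x ^+ 2 * ((x ^+ N * a t N) ^+ 2 + (x ^+ N.+1 * a t N.+1) ^+ 2)))%R.
Proof.
move=> /andP[x0 x2] eta0 r1 beta0 hb m0 hm [_ da a0E].
set eta := x ^+ 2 - 2 / x in eta0 hm *.
set c := eta * (1 - (x / 2) ^+ 2) / 4 in hm *.
have q01 : 0 <= x / 2 < 1 by apply/andP; split; lra.
have c0 : 0 < c.
  by rewrite /c divr_gt0// mulr_gt0// subr_gt0 expr_lt1; case/andP: q01.
have cm0 : 0 < c * m by exact: mulr_gt0.
set T := 2 / (c * m); have T0 : 0 < T by rewrite divr_gt0.
have ca j : {within `[0, T], continuous (fun t => a t j)}.
  by apply: (is_derive0y_continuous T0) => t; exact: da.
have cX (f : R -> R) n : {within `[0, T], continuous f} ->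
    {within `[0, T], continuous (fun t => f t ^+ n)}.
  move=> cf t; apply: (@continuous_comp (subspace `[0, T]) R R f (@GRing.exp R ^~ n)).
    exact: cf.
  exact: exprn_continuous.
have cb j : {within `[0, T], continuous (fun t => (x ^+ j * a t j) ^+ 2)}.
  by apply: cX => t; apply: cvgMl_tmp; exact: ca.
pose S t := \sum_(j < N.+1) (x ^+ 2 / 2) ^+ j * a t j.
pose S' t := \sum_(j < N.+1) (x ^+ 2 / 2) ^+ j * dyadic_rhs gamma beta (a t) j.
pose p t := 1 - c / 2 * m * t.
(* [m / p t] solves [y' = c / 2 * y ^ 2] and explodes at [T]; multiplying
   [S - m / p] by the integrating factor [p ^ 4] removes the singularity. *)
pose F t := S t * p t ^+ 4 - m * p t ^+ 3.
pose F' t := S' t * p t ^+ 4 - 2 * c * m * S t * p t ^+ 3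
             + 3 / 2 * c * m ^+ 2 * p t ^+ 2.
have cS : {within `[0, T], continuous S}.
  move=> t; apply: cvg_big => [|j _]; last by apply: cvgMl_tmp; exact: ca.
  exact: add_continuous.
have cp : {within `[0, T], continuous p}.
  apply: continuous_subspaceT => t; apply: cvgB; first exact: cvg_cst.
  by apply: cvgMl_tmp; exact: cvg_id.
have FT : F T = 0.
  have pT : p T = 0.
    by rewrite /p /T; field; rewrite !gt_eqF.
  by rewrite /F pT !expr0n !mulr0 subrr.
have F0 : F 0 = \sum_(j < N.+1) (x ^+ 2 / 2) ^+ j * a0 j - m.
  rewrite /F /p mulr0 subr0 !expr1n !mulr1; congr (_ - _).
  by apply: eq_bigr => j _; rewrite a0E.
rewrite -F0 -subr_le0 -[leRHS]FT.
apply: (@increment_ge_integral _ F F') => //.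
- move=> t; apply: cvgB.
    by apply: cvgM; [exact: cS|exact: cX].
  by apply: cvgMl_tmp; exact: cX.
- move=> t; apply: cvgMl_tmp; apply: cvgD; exact: cb.
- move=> t; rewrite in_itv/= => /andP[t0 tT].
  have da' j : is_derive t 1 (fun u => a u j) (dyadic_rhs gamma beta (a t) j).
    by have [/(_ t0)] := da t j (ltW t0).
  have dS : is_derive t 1 S (S' t).
    rewrite [S](_ : _ = \sum_(j < N.+1) (x ^+ 2 / 2) ^+ j \*: (fun u => a u j)).
      by apply: is_derive_sum => j; apply: is_deriveZ.
    by apply/funext => u; rewrite /S fct_sumE.
  have dp : is_derive t 1 p (- (c / 2 * m)).
    rewrite [p](_ : _ = cst 1 - c / 2 * m \*: id)//.
    by apply: is_derive_eq; rewrite sub0r scaler1.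
  rewrite [F](_ : _ = S * p ^+ 4 - m \*: p ^+ 3).
    apply: is_derive_eq; rewrite /F' !fctE /GRing.scale /=.
    by field.
  by apply/funext => u; rewrite /F !fctE.
- move=> t; rewrite in_itv/= => /andP[t0 tT].
  have p01 : 0 <= p t <= 1.
    have cm2 : 0 < c / 2 * m by apply: mulr_gt0 => //; lra.
    have : c / 2 * m * t <= c / 2 * m * T by rewrite ler_pM2l// ltW.
    have -> : c / 2 * m * T = 1 by rewrite /T; field; rewrite !gt_eqF.
    have : 0 <= c / 2 * m * t by rewrite mulr_ge0 ?ltW.
    by rewrite /p => ? ?; apply/andP; split; lra.
  have SE : S t = \sum_(j < N.+1) (x / 2) ^+ j * (x ^+ j * a t j).
    apply: eq_bigr => j _; rewrite mulrA -exprMn; congr (_ ^+ _ * _).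
    by field.
  rewrite /F' SE.
  apply: (riccati_step_ge (b := fun j => x ^+ j * a t j) q01 eta0 _ p01 hm).
    by rewrite mulr_ge0 ?sqr_ge0// addr_ge0 ?sqr_ge0.
  exact: weighted_rhs_ge.
Qed.

(** * Choice of parameters and contradiction *)

Theorem theorem2 (R : realType) (s gamma : R)
    (hs : 1 / 3 < s) (hgamma0 : 0 < gamma) (hgamma : gamma < 1 / 3) :
  exists2 beta_sg : R, 0 < beta_sg &
    forall beta : R, 0 <= beta -> beta < beta_sg ->
      exists C : set (nat -> R),
        [/\ C !=set0,
            forall a0, C a0 -> (Hs_norm2 s a0 < +oo)%E
          & forall a0, C a0 ->
              forall a : R -> nat -> R, is_solution gamma beta a0 a ->
                exists2 T : R, 0 < T &
                  (\int[lebesgue_measure]_(t in `[0%R, T]) Hs_norm2 s (a t)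
                    = +oo)%E].
Proof.
(* For [gamma < 1 / 3], the number [2 / 3 - gamma] lies strictly between [1 / 3] and
   [1 - 2 * gamma]. *)
pose sigma := Num.min s (2 / 3 - gamma).
have sigma_s : sigma <= s by rewrite ge_min lexx.
have sigma_gt : 1 / 3 < sigma by rewrite lt_min hs; lra.
have sigma_lt : sigma < 1 - 2 * gamma.
  have : sigma <= 2 / 3 - gamma by rewrite ge_min lexx orbT.
  by lra.
pose x : R := 2 `^ sigma.
have two_lt (u v : R) : u < v -> 2 `^ u < 2 `^ v.
  move=> uv; rewrite lt_neqAle; apply/andP; split; last by rewrite ler_powR ?ler1n ?ltW.
  have ln2 : ln (2 : R) != 0 by rewrite gt_eqF// ln_gt0// ltr1n.
  apply/eqP => /(congr1 (@ln R)); rewrite !ln_powR => /(mulIf ln2) uE.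
  by rewrite uE ltxx in uv.
have x0 : 0 < x by rewrite powR_gt0.
have x2 : x < 2 by rewrite -[ltRHS]powRr1//; apply: two_lt; lra.
have x3 : 2 < x ^+ 3.
  by rewrite -powR_mulrn ?powR_ge0// -powRrM -[ltLHS]powRr1//; apply: two_lt; lra.
have eta0 : 0 < x ^+ 2 - 2 / x.
  by rewrite subr_gt0 ltr_pdivrMr// -exprSr.
have wx : 2 `^ (2 * gamma) * x / 2 < 1.
  rewrite ltr_pdivrMr// mul1r -powRD ?pnatr_eq0 ?implybT//.
  by rewrite -[ltRHS]powRr1//; apply: two_lt; lra.
have d0 : 0 < x + 2 / x ^+ 2 by rewrite addr_gt0// divr_gt0// exprn_gt0.
set eta := x ^+ 2 - 2 / x in eta0.
exists (eta / (2 * (x + 2 / x ^+ 2))); first by rewrite divr_gt0// mulr_gt0.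
move=> beta beta0; rewrite ltr_pdivlMr ?mulr_gt0// => beta_lt.
have hb : 2 * beta * (x + 2 / x ^+ 2) <= eta by rewrite mulrAC mulrC ltW.
set r := 2 `^ (2 * gamma) * x / 2 in wx.
pose c := eta * (1 - (x / 2) ^+ 2) / 4.
pose A := 2 / (eta * (1 - r ^+ 2)).
have r0 : 0 <= r by rewrite divr_ge0// mulr_ge0 ?powR_ge0 ?ltW.
have c0 : 0 < c.
  by rewrite divr_gt0// mulr_gt0// subr_gt0 expr_lt1// ?divr_ge0 ?(ltW x0)//; lra.
have A0 : 0 < A by rewrite divr_gt0// mulr_gt0// subr_gt0 expr_lt1.
(* With [m >= 1], also [m ^+ 2 >= m >= A / c], so the constant lost to damping is absorbed. *)
pose m := 1 + A / c.
have m1 : 1 <= m by rewrite lerDl ltW// divr_gt0.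
have m0 : 0 < m by lra.
have hm : A <= c * m ^+ 2.
  have -> : A = c * (A / c) by field; rewrite gt_eqF.
  rewrite ler_wpM2l ?(ltW c0)//; apply: (@le_trans _ _ m); first by rewrite lerDr.
  by rewrite expr2 ler_peMr// ltW.
(* All the mass sits in mode 0, so for every [N] the weighted sum exceeds [m] by exactly 1. *)
pose a1 (j : nat) : R := if j is 0 then m + 1 else 0.
exists [set a1]; split; first by exists a1.
  move=> _ ->; rewrite /Hs_norm2 (nneseries_split 0 1); last first.
    by move=> j _; rewrite lee_fin mulr_ge0 ?powR_ge0 ?sqr_ge0.
  rewrite big_nat1 eseries0 ?adde0 ?ltry//.
  by case=> // j _ _; rewrite /a1 expr0n mulr0.
move=> _ -> a sol.
have T0 : 0 < 2 / (c * m) by rewrite divr_gt0// mulr_gt0.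
exists (2 / (c * m)) => //.
have [_ da _] := sol.
have ca j := is_derive0y_continuous T0 (fun t => da t j).
apply/eqP; rewrite -leye_eq leNgt; apply/negP => fin.
pose f j t := 2 `^ (2 * s * j%:R) * a t j ^+ 2.
have cf j : {within `[0, 2 / (c * m)], continuous (f j)}.
  by move=> t; apply: cvgMl_tmp; apply: cvgM; exact: ca.
have f0 j t : 0 <= f j t by rewrite mulr_ge0 ?powR_ge0 ?sqr_ge0.
(* This threshold cancels the factor [x ^+ 2] of the truncation loss, which is thus below 1, against
   an excess of 1. *)
have e0 : 0 < x ^- 2 by rewrite invr_gt0 exprn_gt0.
have [N hN] := consecutive_integrals_small f0 cf fin e0.
have x02 : 0 < x < 2 by rewrite x0.
have := initial_transfer_le N x02 eta0 wx beta0 hb m0 hm sol.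
rewrite big_ord_recl big1 => [|j _]; last by rewrite /a1 mulr0.
rewrite expr0 mul1r addr0 /= addrAC subrr add0r leNgt => /negP; apply.
(* Here [sigma <= s] lets the H^s terms dominate the truncation terms. *)
have b_le j t : (x ^+ j * a t j) ^+ 2 <= f j t.
  rewrite exprMn /f ler_wpM2r ?sqr_ge0// -exprM mulnC -powR_mulrn ?powR_ge0//.
  rewrite -powRrM ler_powR ?ler1n// natrM mulrA [sigma * 2]mulrC.
  by rewrite ler_wpM2r ?ler0n// ler_wpM2l.
have iT (h : R -> R) : {within `[0, 2 / (c * m)], continuous h} ->
    lebesgue_measure.-integrable `[0, 2 / (c * m)] (EFin \o h).
  by move=> ch; apply: continuous_compact_integrable => //; exact: segment_compact.
have cff : {within `[0, 2 / (c * m)], continuous (fun t => f N t + f N.+1 t)}.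
  by move=> t; apply: cvgD; exact: cf.
have cb j : {within `[0, 2 / (c * m)],
    continuous (fun t => (x ^+ j * a t j) ^+ 2)}.
  by move=> t; apply: cvgM; apply: cvgMl_tmp; exact: ca.
rewrite -(ltr_pM2l (exprn_gt0 2 x0)) divff ?gt_eqF ?exprn_gt0// in hN.
apply: le_lt_trans hN; rewrite -RintegralZl//; last exact: iT.
apply: le_Rintegral => //.
- by apply: iT => t; apply: cvgMl_tmp; apply: cvgD; exact: cb.
- by apply: iT => t; apply: cvgMl_tmp; exact: cff.
- move=> t _; apply: ler_wpM2l; first exact: sqr_ge0.
  by apply: lerD; exact: b_le.
Qed.
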